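(* Let $\Omega\subset\mathbb R^d$ be an open set and let $\phi\in W^{1,1}(\Omega)$ satisfy the measure preserving condition (MPC). Then $\phi$ is subharmonic in $\Omega$, that is, $$-\int_{\Omega}\nabla\phi(x)\cdot\nabla\psi(x)\,\mathrm dx\ \ge\ 0\qquad\text{for all }\psi\in C^1_c(\Omega)\text{ with }\psi\ge 0.$$
   Context: $\mathscr L^d$ denotes the $d$-dimensional Lebesgue measure, $\llcorner$ denotes restriction of a measure, and $T_\sharp$ denotes push-forward. A measurable map $T:\Omega\to\mathbb R^d$ is called measure preserving on a measurable set $F\subset\Omega$ if for all measurable $A\subset\Omega$ the set $T(F\cap A)$ is measurable and $T_\sharp\big(\mathscr L^d\llcorner(F\cap A)\big)=\mathscr L^d\llcorner T(F\cap A)$. A function $\phi:\Omega\to\mathbb R$ in $W^{1,1}(\Omega)$ satisfies the measure preserving condition (MPC) if there is a set $F\subset\Omega$ of full measure (i.e. $\mathscr L^d(\Omega\setminus F)=0$) such that for a.e. $t\ge 0$ the map $T_t:\Omega\to\mathbb R^d$, $T_t(x):=x+t\nabla\phi(x)$, is measure preserving on $F$. Here $\nabla\phi$ is the weak gradient (any fixed measurable representative). *)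

(* Defs.v *)
From HB Require Import structures.
From mathcomp Require Import all_boot all_order all_algebra.
From mathcomp Require Import all_classical all_reals all_analysis.

Set Implicit Arguments.
Unset Strict Implicit.
Unset Printing Implicit Defensive.

Import Order.TTheory GRing.Theory Num.Theory.
Import numFieldNormedType.Exports.

Local Open Scope classical_set_scope.
Local Open Scope ring_scope.

(** * Multi-dimensional Lebesgue measure

    This is the Lebesgue outer measure on row vectors, defined by countable
    covers by half-open boxes, restricted to its Caratheodory measurable sets,
    which form the (complete) sigma-algebra of Lebesgue measurable sets.  The
    dimension is d.+1: in dimension 0 every box has volume 1, so that covers by
    sequences of boxes would not give measure 0 to the empty set. *)
Section lebesgue.
Context {R : realType} {d : nat}.
Local Notation V := 'rV[R]_d.+1.
Implicit Types (X : set V) (a b : V) (F : (V * V)^nat).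

Definition box a b : set V :=
  [set x | forall i, a ord0 i < x ord0 i <= b ord0 i].

(* The maximum makes the volume of an empty box 0. *)
Definition box_volume a b : R :=
  \prod_(i < d.+1) Num.max 0 (b ord0 i - a ord0 i).

Definition box_cover X : set ((V * V)^nat) :=
  [set F | X `<=` \bigcup_k box (F k).1 (F k).2].

Definition lebesgue_outer X : \bar R :=
  ereal_inf [set (\sum_(k <oo) (box_volume (F k).1 (F k).2)%:E)%E
            | F in box_cover X].

Local Open Scope ereal_scope.

Local Lemma box_volume_ge0 a b : 0 <= (box_volume a b)%:E.
Proof. by rewrite lee_fin; apply: prodr_ge0 => i _; rewrite le_max lexx. Qed.

Local Lemma lebesgue_outer_ge0 X : 0 <= lebesgue_outer X.
Proof.
apply: le_ereal_inf_tmp => _ [F _ <-].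
by apply: nneseries_ge0 => k _ _; exact: box_volume_ge0.
Qed.

Local Lemma lebesgue_outer0 : lebesgue_outer set0 = 0.
Proof.
apply/eqP; rewrite eq_le lebesgue_outer_ge0 andbT.
apply: ereal_inf_lbound; exists (fun=> (0%R, 0%R)); first by move=> x [].
apply: eseries0 => k _ _; congr (_%:E).
by rewrite /box_volume big_ord_recl subrr maxxx mul0r.
Qed.

Local Lemma le_lebesgue_outer : {homo lebesgue_outer : A B / A `<=` B >-> A <= B}.
Proof.
move=> A B AB; apply/ereal_inf_le_tmp => _ [F BF <-].
by exists F => //; exact: subset_trans BF.
Qed.

Local Lemma lebesgue_outer_sigma_subadditive : sigma_subadditive lebesgue_outer.
Proof.
pose vol (p : V * V) : \bar R := (box_volume p.1 p.2)%:E.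
have vol_ge0 p : 0 <= vol p by exact: box_volume_ge0.
move=> A; have [[i ioo]|] := pselect (exists i, lebesgue_outer (A i) = +oo).
  rewrite (eseries_pinfty _ _ ioo) ?leey// => n _.
  by rewrite -ltNye (lt_le_trans _ (lebesgue_outer_ge0 _)).
rewrite -forallNE => Aoo.
apply/lee_addgt0Pr => e e0.
rewrite (le_trans _ (epsilon_trick _ _ (ltW e0)))//; last first.
  by move=> n; exact: lebesgue_outer_ge0.
pose P n (F : (V * V)^nat) := box_cover (A n) F /\
  \sum_(k <oo) vol (F k) <= lebesgue_outer (A n) + (e / (2 ^ n.+1)%:R)%:E.
have [G PG] : {G : ((V * V)^nat)^nat & forall n, P n (G n)}.
  apply: (@choice _ _ P) => n.
  have en : (0 < e / (2 ^ n.+1)%:R)%R by rewrite divr_gt0.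
  have fA : lebesgue_outer (A n) \is a fin_num.
    by rewrite ge0_fin_numE ?lebesgue_outer_ge0// ltey; apply/eqP/Aoo.
  have [_ [F AF <-] lF] := lb_ereal_inf_adherent en fA.
  by exists F; split => //; exact: ltW.
apply: (@le_trans _ _ (\esum_(p in setT) vol (G p.1 p.2))).
  have /card_esym/ppcard_eqP[f] := card_nat2.
  apply: ereal_inf_lbound; exists (fun k => G (f k).1 (f k).2).
    move=> x [i _ Aix]; have [j _ Gij] := (PG i).1 _ Aix.
    by exists (f^-1%FUN (i, j)) => //=; rewrite invK ?inE.
  rewrite nneseries_esumT; last by move=> k; exact: box_volume_ge0.
  by rewrite [RHS](reindex_esum setT setT f).
rewrite (_ : [set: nat * nat] = \bigcup_i [set (i, j) | j in setT]); last first.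
  by apply/seteqP; split => [[i j] _|//]; exists i => //; exists j.
rewrite esum_bigcupT//; last first.
  apply/trivIsetP => i j _ _ /eqP ij; rewrite -subset0 => x [[? _ <-]] [? _].
  by move=> [/esym].
rewrite -nneseries_esumT; last by move=> i; exact: esum_ge0.
apply: lee_nneseries => [i _ _|i _]; first exact: esum_ge0.
apply: le_trans (PG i).2.
rewrite nneseries_esumT// (reindex_esum setT [set (i, j) | j in setT] (pair i))//.
by split => // j k _ _ [].
Qed.

HB.instance Definition _ := isOuterMeasure.Build R V lebesgue_outer
  lebesgue_outer0 lebesgue_outer_ge0 le_lebesgue_outer
  lebesgue_outer_sigma_subadditive.

End lebesgue.

(** [Leb R d] and [Bor R d] are both R^(d+1), equipped with the sigma-algebra
    of Lebesgue measurable sets and of Borel sets respectively. *)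
Notation Leb R d := (caratheodory_type (@lebesgue_outer R d)).
Notation Bor R d := (g_sigma_algebraType (@open 'rV[R]_d.+1)).

Definition lebesgue_rV (R : realType) (d : nat) :
    {measure set (Leb R d) -> \bar R} :=
  let mu : {outer_measure set 'rV[R]_d.+1 -> \bar R} := @lebesgue_outer R d in
  (mu : set (caratheodory_type mu) -> \bar R).

Section definitions.
Context {R : realType} {d : nat}.
Local Notation V := 'rV[R]_d.+1.
Local Notation lambda := (lebesgue_rV R d).
Implicit Types (Omega F : set V) (phi psi : V -> R) (g : V -> V).

Definition dotmul (u v : V) : R := \sum_i u ord0 i * v ord0 i.

Definition partial (i : 'I_d.+1) psi : V -> R := 'D_(delta_mx ord0 i) psi.

Definition grad psi : V -> V := fun x => \row_i partial i psi x.

Fixpoint Ck (k : nat) psi : Prop :=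
  continuous psi /\
  if k is k'.+1 then
    forall i : 'I_d.+1,
      (forall x, derivable psi x (delta_mx ord0 i)) /\ Ck k' (partial i psi)
  else True.

(* Functions compactly supported in Omega are identified with their extension
   by zero to the whole space. *)
Definition compactly_supported Omega psi : Prop :=
  compact (closure [set x | psi x != 0]) /\
  closure [set x | psi x != 0] `<=` Omega.

Definition C1c Omega psi : Prop := Ck 1 psi /\ compactly_supported Omega psi.

Definition Coo_c Omega psi : Prop :=
  (forall k, Ck k psi) /\ compactly_supported Omega psi.

(* phi belongs to W^{1,1}(Omega) and g is a representative of its weak
   gradient.  Only the values of phi and g in Omega matter. *)
Definition W11_with_gradient Omega phi g : Prop :=
  [/\ lambda.-integrable Omega (EFin \o phi),
      forall i, lambda.-integrable Omega (fun x => (g x ord0 i)%:E) &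
      forall (eta : V -> R) (i : 'I_d.+1), Coo_c Omega eta ->
        (\int[lambda]_(x in Omega) (phi x * partial i eta x)%:E =
         - \int[lambda]_(x in Omega) (g x ord0 i * eta x)%:E)%E].

(* [T] is only meaningful on [Omega], which contains [F].  The measures
   T_#(lambda|_(F n A)) and lambda|_(T(F n A)) are compared on Borel sets. *)
Definition measure_preserving_on Omega (T : V -> V) F : Prop :=
  measurable_fun (Omega : set (Leb R d)) (T : Leb R d -> Bor R d) /\
  forall A : set (Leb R d), measurable A -> A `<=` Omega ->
    exists (mFA : measurable (F `&` A : set (Leb R d)))
           (mTFA : measurable (T @` (F `&` A) : set (Leb R d))),
    forall B : set (Bor R d), measurable B ->
      pushforward (mrestr lambda mFA) (T : Leb R d -> Bor R d) B =
      mrestr lambda mTFA B.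

(* The measure preserving condition depends on the function only through a
   representative g of its weak gradient. *)
Definition MPC Omega g : Prop :=
  exists F : set (Leb R d),
    [/\ measurable F, F `<=` Omega, lambda (Omega `\` F) = 0%E &
        {ae @lebesgue_measure R, forall t : R, 0 <= t ->
          measure_preserving_on Omega (fun x => x + t *: g x) F}].

End definitions.

(* Main.v *)
Require Import Defs.
From mathcomp Require Import all_boot all_order all_algebra.
From mathcomp Require Import all_classical all_reals all_analysis.
From mathcomp Require Import measurable_realfun.
Import Order.TTheory GRing.Theory Num.Theory.
Import numFieldNormedType.Exports.
Local Open Scope classical_set_scope.
Local Open Scope ring_scope.

(** Transporting mass by x |-> x + t g(x), where g = gradphi, cannot increase
    the integral of a nonnegative psi that vanishes outside Omega.  Indeed,
    measure preservation on the full measure set F gives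
      \int_Omega psi(x + t g(x)) dx = \int_(T_t(F)) psi(y) dy
                                   <= \int_Omega psi(y) dy
    (integral_comp_measure_preserving_le), so that the difference quotients
      q_t(x) = (psi(x + t g(x)) - psi(x)) / t
    have nonpositive integral for almost every t > 0.  As psi is C^1 with
    bounded gradient, q_t is dominated by a multiple of \sum_i |g_i|, which is
    integrable, and q_t(x) tends to g(x) . grad psi(x) as t tends to 0.
    Dominated convergence along a sequence of admissible times tending to 0
    then gives \int_Omega g . grad psi <= 0.

    The Lebesgue measure of the statement comes from the outer measure of box
    covers, and its outer measure properties carry the proof.  The comparison of
    integrals is reduced to a comparison of the measures of preimages of Borel
    sets of reals (le_integral_preimage), where monotonicity and subadditivity
    of the outer measure suffice.  Omega is measurable because it differs from
    F by a null set.  That psi is Lebesgue measurable on Omega is deduced, not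
    from the measurability of boxes, but from that of the T_t, because psi is
    the pointwise limit of the measurable functions psi \o T_t. *)

(** * Comparison of integrals through preimages *)

(** Both integrals are those of the identity against the laws of [f] and [h] on
    the reals.  The points where a function vanishes do not contribute, so it is
    enough to compare these laws on sets that avoid 0. *)
Lemma le_integral_preimage d (T : measurableType d) (R : realType)
    (mu : {measure set T -> \bar R}) (D : set T) (f h : T -> R) :
  measurable D -> measurable_fun D f -> measurable_fun D h ->
  (forall x, D x -> 0 <= f x) -> (forall x, D x -> 0 <= h x) ->
  (forall B : set R, measurable B -> ~ B 0%R ->
    mu (D `&` f @^-1` B) <= mu (D `&` h @^-1` B))%E ->
  (\int[mu]_(x in D) (f x)%:E <= \int[mu]_(x in D) (h x)%:E)%E.
Proof.
move=> mD mf mh f0 h0 fh.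
pose Z : set R := ~` [set 0].
have mZ : measurable Z by apply: measurableC; exact: measurable_set1.
(* The absolute value is the identity on the values of [f] and [h] in [D], and
   the pushforward formula asks for a nonnegative integrand on all of [Z]. *)
pose nrm (y : R) : \bar R := (`|y|%R)%:E.
have mnrm : measurable_fun setT (nrm : R -> \bar R).
  by apply/measurable_EFinP; exact: normr_measurable.
(* Extension by zero to all of [T] does not change the preimages of sets avoiding 0. *)
have preE (u : T -> R) (B : set R) : ~ B 0 ->
    (u \_ D) @^-1` B = D `&` u @^-1` B.
  move=> B0; apply/seteqP; split => x /=; rewrite patchE; case: ifPn.
  - by rewrite inE.
  - by [].
  - by move=> _ [].
  - by rewrite notin_setE => nD [].
have mpatch (u : T -> R) : measurable_fun D u -> measurable_fun setT (u \_ D).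
  by move=> mu'; apply/(measurable_restrictT _ _).1.
have intE (u : T -> R) : measurable_fun D u -> (forall x, D x -> 0 <= u x) ->
    (\int[mu]_(x in D) (u x)%:E =
     \int[pushforward mu (u \_ D)]_(y in Z) nrm y)%E.
  move=> mu' u0; rewrite [RHS]ge0_integral_pushforward//; last 3 first.
  - exact: mpatch.
  - exact: measurable_funS mnrm.
  - by move=> y _; rewrite lee_fin.
  rewrite integral_mkcond [RHS]integral_mkcond; apply: eq_integral => x _.
  rewrite preE/=; last exact.
  rewrite !patchE in_setI /nrm/= patchE; case: ifPn => //= xD.
  have ux0 : 0 <= u x by apply: u0; rewrite -inE.
  case: ifPn; first by rewrite ger0_norm.
  by rewrite notin_setE/= => /contrapT ->.
rewrite !intE//.
have mfs := mpatch _ mf; have mhs := mpatch _ mh.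
rewrite [leLHS](eq_measure_integral (mrestr (pushforward mu (f \_ D)) mZ)).
  rewrite [leRHS](eq_measure_integral (mrestr (pushforward mu (h \_ D)) mZ)).
    apply: ge0_le_measure_integral => //.
      move=> B mB.
      change (mu ((f \_ D) @^-1` (B `&` Z)) <= mu ((h \_ D) @^-1` (B `&` Z)))%E.
      have BZ0 : ~ (B `&` Z) 0 by move=> -[_ /(_ erefl)].
      by rewrite !preE//; apply: fh => //; exact: measurableI.
    by move=> y; rewrite lee_fin.
  by move=> B _ BZ /=; rewrite /mrestr setIidl.
by move=> B _ BZ /=; rewrite /mrestr setIidl.
Qed.

(** * First-order expansion of C^1 functions of several variables *)

Section calculus.
Context {R : realType}.

Lemma is_derive_line {V : normedModType R} (f : V -> R) (y e : V) (s : R) :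
  derivable f (y + s *: e) e ->
  is_derive s 1 (fun u => f (y + u *: e)) ('D_e f (y + s *: e)).
Proof.
move=> df.
have E : (fun h : R => h^-1 *: (f (y + (h *: 1 + s) *: e) - f (y + s *: e))) =
         (fun h : R => h^-1 *: (f (h *: e + (y + s *: e)) - f (y + s *: e))).
  by apply/funext => h; rewrite scalerDl [h *: 1]mulr1 addrCA.
split; first by rewrite /derivable/= E.
by rewrite /derive/= E.
Qed.

(** Parametrizing the segment by [0, 1] instead of by [0, c] treats both signs
    of [c] at once. *)
Lemma line_mean_value {V : normedModType R} (f : V -> R) (y e : V) (c : R) :
  (forall z, derivable f z e) ->
  exists2 s, `|s| <= `|c| & f (y + c *: e) - f y = c * 'D_e f (y + s *: e).
Proof.
move=> df; pose g u := f (y + (u * c) *: e).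
have dg u : is_derive u (1 : R) g ('D_e f (y + (u * c) *: e) * c).
  apply: (@is_derive1_comp _ (fun w => f (y + w *: e)) (fun u => u * c)).
    exact: is_derive_line.
  by apply: is_derive_eq; rewrite scaler0 add0r [_%:A]mulr1.
have [s sI gE] : exists2 s, s \in `[0, 1]%R &
    g 1 - g 0 = 'D_e f (y + (s * c) *: e) * c * (1 - 0).
  apply: (@MVT_segment _ _ (fun u => 'D_e f (y + (u * c) *: e) * c)) => //.
  apply: (@derivable_within_continuous _ R^o g) => u _; exact: ex_derive.
move: sI; rewrite in_itv/= => /andP[s0 s1].
exists (s * c); first by rewrite normrM ger0_norm// ler_piMl.
by move: gE; rewrite /g mul1r mul0r scale0r addr0 subr0 mulr1 mulrC.
Qed.

End calculus.

Lemma normr_row_le (R : realType) (n : nat) (u : 'rV[R]_n) (M : R) :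
  0 <= M -> (forall j, `|u ord0 j| <= M) -> `|u| <= M.
Proof.
move=> M0 uM; rewrite /Num.norm/= mx_normrE; apply: bigmax_le => // -[i j] _ /=.
by rewrite (ord1 i).
Qed.

Lemma normr_coord_le (R : realType) (n : nat) (u : 'rV[R]_n) (j : 'I_n) :
  `|u ord0 j| <= `|u|.
Proof.
rewrite {2}/Num.norm/= mx_normrE.
exact: (le_bigmax _ (fun ij : 'I_1 * 'I_n => `|u ij.1 ij.2|) (ord0, j)).
Qed.

Section gradient.
Context {R : realType} {d : nat}.
Local Notation V := 'rV[R]_d.+1.
Implicit Types (psi : V -> R) (x h : V).

(** Moving from [x] to [x + h] along one coordinate direction at a time reduces
    the increment to one-variable increments, to which the mean value theorem
    applies because [Ck 1] provides the partial derivatives.  The points [xi i]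
    stay within [`|h|] of [x] since the norm is the maximum norm. *)
Lemma C1_mean_value psi x h : Ck 1 psi ->
  exists2 xi : 'I_d.+1 -> V, forall i, `|xi i - x| <= `|h| &
    psi (x + h) - psi x = \sum_i h ord0 i * partial i psi (xi i).
Proof.
move=> [_ C1].
(* [p k] has already moved along the first [k] coordinates. *)
pose p (k : nat) : V := x + \row_j (if (j < k)%N then h ord0 j else 0).
have pS (i : 'I_d.+1) : p i.+1 = p i + h ord0 i *: delta_mx ord0 i.
  rewrite /p -addrA; congr (_ + _); apply/rowP => j; rewrite !mxE eqxx/=.
  rewrite ltnS; case: (ltngtP j i) => [ji|ij|/val_inj ->].
  - by rewrite -val_eqE/= ltn_eqF// mulr0 addr0.
  - by rewrite -val_eqE/= gtn_eqF// mulr0 addr0.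
  - by rewrite eqxx mulr1 add0r.
have step (i : 'I_d.+1) : exists xi : V, `|xi - x| <= `|h| /\
    psi (p i.+1) - psi (p i) = h ord0 i * partial i psi xi.
  have [s sh psiE] :=
    line_mean_value psi (p i) (delta_mx ord0 i) (h ord0 i) (C1 i).1.
  exists (p i + s *: delta_mx ord0 i); split; last by rewrite pS.
  apply: normr_row_le => // j; rewrite !mxE eqxx/= addrAC [x _ _ + _]addrC addrK.
  case: (ltngtP j i) => [ji|ij|/val_inj ->].
  - by rewrite -val_eqE/= ltn_eqF// mulr0 addr0 normr_coord_le.
  - by rewrite -val_eqE/= gtn_eqF// mulr0 addr0 normr0.
  - by rewrite eqxx mulr1 add0r (le_trans sh)// normr_coord_le.
have [xi xiP] := choice step.
exists xi => [i|]; first exact: (xiP i).1.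
have -> : x + h = p d.+1.
  by congr (_ + _); apply/rowP => j; rewrite !mxE ltn_ord.
have -> : psi x = psi (p 0%N).
  congr psi; rewrite /p -[LHS]addr0; congr (_ + _).
  by apply/rowP => j; rewrite !mxE.
rewrite -(@telescope_sumr _ 0 d.+1 (psi \o p))// big_mkord.
by apply: eq_bigr => i _; exact: (xiP i).2.
Qed.

Lemma dotmul_grad psi x h :
  dotmul h (grad psi x) = \sum_i h ord0 i * partial i psi x.
Proof. by apply: eq_bigr => i _; rewrite mxE. Qed.

Let cvg_sumr (I : Type) (r : seq I) (f : I -> nat -> R) (l : I -> R) :
  (forall i, f i @ \oo --> l i) ->
  (fun n => \sum_(i <- r) f i n) @ \oo --> \sum_(i <- r) l i.
Proof.
move=> fl; elim: r => [|i r IHr].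
  by rewrite big_nil; under eq_fun do rewrite big_nil; exact: cvg_cst.
by rewrite big_cons; under eq_fun do rewrite big_cons; exact: cvgD.
Qed.

(** The intermediate points of the mean value formula tend to [x], where the
    partial derivatives are continuous. *)
Lemma cvg_difference_quotient psi x h (t : nat -> R) : Ck 1 psi ->
  (forall n, 0 < t n) -> t @ \oo --> 0 ->
  (fun n => (t n)^-1 * (psi (x + t n *: h) - psi x)) @ \oo -->
    dotmul h (grad psi x).
Proof.
move=> C1 t0 tcvg; rewrite dotmul_grad.
have /choice[xi xiP] : forall n, exists xi : 'I_d.+1 -> V,
    (forall i, `|xi i - x| <= `|t n *: h|) /\
    psi (x + t n *: h) - psi x =
      \sum_i (t n *: h) ord0 i * partial i psi (xi i).
  by move=> n; have [xi ? ?] := C1_mean_value psi x (t n *: h) C1; exists xi.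
have -> : (fun n => (t n)^-1 * (psi (x + t n *: h) - psi x)) =
    (fun n => \sum_i h ord0 i * partial i psi (xi n i)).
  apply/funext => n; rewrite (xiP n).2 mulr_sumr; apply: eq_bigr => i _.
  by rewrite mxE -mulrA mulKf// gt_eqF.
have xicvg i : xi ^~ i @ \oo --> x.
  apply/cvgrPdistC_lt => e e0.
  have : (fun n => t n * `|h|) @ \oo --> 0 * `|h| by apply: cvgMl.
  rewrite mul0r => /cvgrPdist_lt /(_ e e0).
  apply: filterS => n; rewrite sub0r normrN => tn.
  apply: le_lt_trans ((xiP n).1 i) _.
  rewrite normrZ; apply: le_lt_trans tn.
  by rewrite normrM normr_id.
apply: cvg_sumr => i; apply: cvgMr.
exact: (continuous_cvg _ ((C1.2 i).2.1 x)).
Qed.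

(** The partial derivatives are continuous, and vanish outside the support
    because [psi] is locally constant there. *)
Lemma C1c_partial_bounded (Omega : set V) psi : C1c Omega psi ->
  exists2 M, 0 <= M & forall i x, `|partial i psi x| <= M.
Proof.
move=> [C1 [cK _]]; set K := closure _ in cK.
have out i x : ~ K x -> partial i psi x = 0.
  move=> nKx.
  have nb : \forall y \near x, psi y = cst 0 y.
    have : open (~` K) by apply: closed_openC; exact: closed_closure.
    rewrite openE => /(_ x nKx); apply: filterS => y nKy.
    by apply/eqP; apply: contra_notT nKy => psi0; exact: subset_closure.
  by rewrite /partial (near_eq_derive _ nb) derive_cst.
have bnd i : exists2 M, 0 <= M & forall x, `|partial i psi x| <= M.
  have : bounded_set (partial i psi @` K).
    apply: compact_bounded; apply: continuous_compact => //.
    apply: continuous_subspaceT; exact: (C1.2 i).2.1.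
  move=> [M [_ /(_ (`|M| + 1))]].
  rewrite ltr_pwDr ?ler_norm// => /(_ isT) bM.
  exists (`|M| + 1) => // x; have [Kx|nKx] := pselect (K x).
    by apply: bM; exists x.
  by rewrite out// normr0.
have [M MP] := choice (fun i => let: ex_intro2 M M0 MP := bnd i in
  ex_intro _ M (conj M0 MP)).
exists (\sum_i M i) => [|i x]; first by apply: sumr_ge0 => i _; exact: (MP i).1.
rewrite (le_trans ((MP i).2 x))// (bigD1 i)//= lerDl.
by apply: sumr_ge0 => j _; exact: (MP j).1.
Qed.

Lemma le_difference_quotient psi x h (t M : R) : Ck 1 psi -> 0 < t ->
  (forall i y, `|partial i psi y| <= M) ->
  `|t^-1 * (psi (x + t *: h) - psi x)| <= M * \sum_i `|h ord0 i|.
Proof.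
move=> C1 t0 pM; have [xi _ ->] := C1_mean_value psi x (t *: h) C1.
rewrite mulr_sumr mulr_sumr; apply: le_trans (ler_norm_sum _ _ _) _.
apply: ler_sum => i _; rewrite mxE -mulrA mulKf ?gt_eqF// normrM mulrC.
exact: ler_wpM2r.
Qed.

End gradient.

(** * Lebesgue measure *)

Lemma lebesgue_outer_bounded_lty (R : realType) (d : nat)
    (A : set 'rV[R]_d.+1) :
  bounded_set A -> (lebesgue_outer A < +oo)%E.
Proof.
move=> [M [_ /(_ (`|M| + 1))]]; rewrite ltr_pwDr ?ler_norm// => /(_ isT) AM.
(* A box contains its upper face but not its lower one, whence [- N - 1]. *)
pose N := `|M| + 1.
pose F (k : nat) : 'rV[R]_d.+1 * 'rV[R]_d.+1 :=
  if k is 0%N then (const_mx (- N - 1), const_mx N) else (0, 0).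
apply: (@le_lt_trans _ _ (\sum_(k <oo) (box_volume (F k).1 (F k).2)%:E)%E).
  apply: ereal_inf_lbound; exists F => // x Ax; exists 0%N => // i; rewrite !mxE.
  have := le_trans (normr_coord_le _ _ x i) (AM x Ax).
  by rewrite -/N ler_norml => /andP[Nx ->]; rewrite andbT (lt_le_trans _ Nx)// gtrBl.
have vol0 k : (0 <= (box_volume (F k).1 (F k).2)%:E)%E.
  by rewrite lee_fin; apply: prodr_ge0 => i _; rewrite le_max lexx.
rewrite nneseries_recl//= eseries0 ?adde0 ?ltry// => -[//|k] _ _ /=.
by rewrite /box_volume big_ord_recl subrr maxxx mul0r.
Qed.

(** Every interval ]0, 1/(n+1)[ has positive measure, so it meets [P]. *)
Lemma ae_small_time (R : realType) (P : R -> Prop) :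
  {ae @lebesgue_measure R, forall t, 0 <= t -> P t} ->
  exists t : nat -> R,
    [/\ forall n, 0 < t n, t @ \oo --> 0 & forall n, P (t n)].
Proof.
move=> [A [mA A0 PA]].
have small n : exists t : R, [/\ 0 < t, t < n.+1%:R^-1 & P t].
  apply: contrapT => nt.
  pose I : set R := `]0, n.+1%:R^-1[%classic.
  have : (lebesgue_measure I <= lebesgue_measure A)%E.
    apply: le_measure; rewrite ?inE//; first exact: measurable_itv.
    move=> t; rewrite /I/= in_itv/= => /andP[t0 tn]; apply: PA => /= Pt.
    by apply: nt; exists t; split => //; apply: Pt; exact: ltW.
  rewrite A0 lebesgue_measure_itv/= lte_fin invr_gt0 ltr0n/= sube0 lee_fin.
  by rewrite leNgt invr_gt0 ltr0n.
have [t tP] := choice small; exists t; split => [n||n].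
- by have [] := tP n.
- apply/cvgr0Pnorm_lt => e e0.
  have := near_infty_natSinv_lt (PosNum e0); apply: filterS => n /=.
  by have [t0 tn _] := tP n; rewrite gtr0_norm//; exact: lt_trans.
- by have [] := tP n.
Qed.

(** * Integration along measure preserving maps *)

Section transport.
Context {R : realType} {d : nat}.
Local Notation V := 'rV[R]_d.+1.
Local Notation lambda := (lebesgue_rV R d).
Implicit Types (Omega F : set V) (T : V -> V) (psi : V -> R).

Lemma lebesgue_null_measurable (N : set (Leb R d)) :
  lambda N = 0%E -> measurable N.
Proof.
move=> N0; apply: le_caratheodory_measurable => X.
rewrite -[leRHS]add0e; apply: leeD; last by apply: le_outer_measure; exact: subIsetl.
by rewrite -N0; apply: le_outer_measure; exact: subIsetr.
Qed.

Lemma continuous_borel_measurable psi : continuous psi ->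
  measurable_fun [set: Bor R d] (psi : Bor R d -> R).
Proof.
move=> /continuousP cpsi; apply: (measurability _ (RGenOpens.measurableE R)).
move=> _ [_ [a [b ->] <-]]; rewrite setTI.
by apply: sub_sigma_algebra; apply: cpsi; exact: interval_open.
Qed.

(** The image of [F] under [T] need not cover [B], hence only an inequality. *)
Lemma measure_preserving_on_le Omega T F (B : set (Bor R d)) :
  measure_preserving_on Omega T F -> measurable (F : set (Leb R d)) ->
  F `<=` Omega -> measurable B ->
  (lebesgue_outer (F `&` T @^-1` B) <= lebesgue_outer B)%E.
Proof.
move=> [_ TF] mF FO mB; have [mFF [mTFF TFB]] := TF F mF FO.
have := TFB B mB; rewrite /pushforward /mrestr setIid setIC => E.
rewrite [leLHS]E; apply: le_outer_measure; exact: subIsetl.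
Qed.

(** Borel sets that avoid 0 have their preimage under [psi] inside [Omega], so
    that it does not matter whether [T] maps [F] into [Omega]. *)
Lemma integral_comp_measure_preserving_le Omega T F psi :
  measure_preserving_on Omega T F -> measurable (Omega : set (Leb R d)) ->
  measurable (F : set (Leb R d)) -> F `<=` Omega ->
  lambda (Omega `\` F) = 0%E -> continuous psi ->
  (forall x, 0 <= psi x) -> (forall x, ~ Omega x -> psi x = 0) ->
  measurable_fun (Omega : set (Leb R d)) (psi : Leb R d -> R) ->
  (\int[lambda]_(x in Omega) (psi (T x))%:E <=
   \int[lambda]_(x in Omega) (psi x)%:E)%E.
Proof.
move=> TF mO mF FO OF0 cpsi psi0 psiO mpsi.
have mB := continuous_borel_measurable psi cpsi.
apply: le_integral_preimage => //.
  exact: (measurableT_comp mB TF.1).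
move=> B mB' B0; have mpB : measurable (psi @^-1` B : set (Bor R d)).
  by rewrite -[X in measurable X]setTI; exact: mB.
have -> : Omega `&` psi @^-1` B = psi @^-1` B.
  apply/setIidPr => x; apply: contraPP => /psiO psix0; rewrite /preimage/= psix0.
  exact.
apply: le_trans (measure_preserving_on_le _ _ _ _ TF mF FO mpB).
have /le_trans : (lebesgue_outer (Omega `&` (psi \o T) @^-1` B) <=
    lebesgue_outer ((Omega `\` F) `|` (F `&` T @^-1` (psi @^-1` B))))%E.
  apply: le_outer_measure => x [Ox psiTx]; have [Fx|nFx] := pselect (F x).
    by right.
  by left.
apply; apply: le_trans (outer_measureU2 _ _ _) _.
by rewrite [X in (X + _)%E]OF0 add0e.
Qed.

(** A bounded function on a set of finite measure is integrable.  The set used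
    is that of the points of [Omega] where [psi] does not vanish: it is bounded,
    as a part of the support, and measurable, as a preimage under [psi]. *)
Lemma integrable_compactly_supported Omega psi :
  measurable (Omega : set (Leb R d)) -> continuous psi ->
  compactly_supported Omega psi ->
  measurable_fun (Omega : set (Leb R d)) (psi : Leb R d -> R) ->
  lambda.-integrable Omega (EFin \o psi).
Proof.
move=> mO cpsi [+ _] mpsi; set K := closure _ => cK.
pose S : set (Leb R d) := Omega `&` psi @^-1` [set~ 0].
have mS : measurable S by apply: mpsi => //; exact: measurableC.
have SK : S `<=` K by move=> x [_ /= /eqP px]; exact: subset_closure.
have psiE : (EFin \o psi) \_ Omega = (EFin \o psi) \_ S.
  apply/funext => x; rewrite !patchE; have [px|/eqP px] := eqVneq (psi x) 0.
    by do 2!case: ifP => _; rewrite /= ?px.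
  by rewrite /S in_setI [x \in psi @^-1` _]mem_set ?andbT.
apply/(integrable_mkcond _ mO); rewrite psiE; apply/(integrable_mkcond _ mS).
have bK : bounded_set K by exact: compact_bounded.
apply: measurable_bounded_integrable => //.
- apply: (lebesgue_outer_bounded_lty _ _ S).
  case: bK => N [Nreal bN]; exists N; split => // r Nr x Sx.
  exact: (bN r Nr x (SK x Sx)).
- by apply: measurable_funS mpsi => // x [].
have : bounded_set (psi @` K).
  apply: compact_bounded; apply: continuous_compact => //.
  exact: continuous_subspaceT cpsi.
case=> N [Nreal bN]; exists N; split => // r Nr x Sx.
by apply: (bN r Nr); exists x => //; exact: SK.
Qed.

End transport.

(** * Subharmonicity *)

Theorem proposition2p4 (R : realType) (d : nat) (Omega : set 'rV[R]_d.+1)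
    (phi : 'rV[R]_d.+1 -> R) (gradphi : 'rV[R]_d.+1 -> 'rV[R]_d.+1) :
  open Omega ->
  W11_with_gradient Omega phi gradphi ->
  MPC Omega gradphi ->
  forall psi : 'rV[R]_d.+1 -> R,
    C1c Omega psi -> (forall x, 0 <= psi x) ->
    (0 <= - \int[lebesgue_rV R d]_(x in Omega)
             (dotmul (gradphi x) (grad psi x))%:E)%E.
Proof.
pose lambda := lebesgue_rV R d.
move=> _ [_ ig _] [F [mF FO OF0 mpT]] psi psiC psi0.
have [C1 [+ +]] := psiC; set K := closure _ => cK KO.
have psiO x : ~ Omega x -> psi x = 0.
  by move=> nOx; apply/eqP; apply: contra_notT nOx => px; apply/KO/subset_closure.
have [t [t0 tcvg mpt]] := ae_small_time _ _ mpT.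
have mO : measurable (Omega : set (Leb R d)).
  rewrite -(setDKU FO); apply: measurableU => //; exact: lebesgue_null_measurable.
pose T n x := x + t n *: gradphi x.
have mpsiT n : measurable_fun (Omega : set (Leb R d)) (psi \o T n : Leb R d -> R).
  exact: (measurableT_comp (continuous_borel_measurable psi C1.1) (mpt n).1).
have mpsi : measurable_fun (Omega : set (Leb R d)) (psi : Leb R d -> R).
  apply: (@measurable_fun_cvg _ (Leb R d) R Omega (fun n => psi \o T n) psi) => //.
  move=> x _.
  have Tx : T n x @[n --> \oo] --> x.
    have {2}-> : x = x + 0 *: gradphi x by rewrite scale0r addr0.
    by apply: cvgD; [exact: cvg_cst|exact: cvgZl].
  exact: (continuous_cvg _ (C1.1 x) Tx).
have psi_int : lambda.-integrable Omega (EFin \o psi).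
  exact: (integrable_compactly_supported _ _ mO C1.1 psiC.2).
have [M M0 pM] := C1c_partial_bounded _ _ psiC.
pose q n (x : Leb R d) : R := (t n)^-1 * (psi (T n x) - psi x).
pose G (x : Leb R d) : R := M * \sum_i `|gradphi x ord0 i|.
have qG n x : `|q n x| <= G x by exact: le_difference_quotient.
have G0 x : 0 <= G x by apply: mulr_ge0 => //; apply: sumr_ge0.
have G_int : lambda.-integrable Omega (EFin \o G).
  rewrite (_ : EFin \o G = fun x => (M%:E * \sum_i `|(gradphi x ord0 i)%:E|)%E).
    apply: integrableZl => //; apply: integrable_sum => // i _.
    exact: integrable_abse.
  by apply/funext => x /=; rewrite EFinM sumEFin.
have mq n : measurable_fun (Omega : set (Leb R d)) (q n).
  apply: measurable_funM; [exact: measurable_cst|].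
  exact: (measurable_funB (mpsiT n) mpsi).
have q_int n : lambda.-integrable Omega (EFin \o q n).
  apply: le_integrable G_int => //; first exact/measurable_EFinP.
  by move=> x _ /=; rewrite lee_fin (le_trans (qG n x))// ler_norm.
have q_le0 n : (\int[lambda]_(x in Omega) (q n x)%:E <= 0)%E.
  have : (\int[lambda]_(x in Omega) (psi (T n x))%:E <=
    \int[lambda]_(x in Omega) (psi x)%:E)%E.
    apply: integral_comp_measure_preserving_le (mpt n) _ _ _ _ _ _ _ _ => //.
    exact: C1.1.
  (* [psi \o T n = psi + t n * q n], and the integral of [psi] is finite. *)
  have -> : (\int[lambda]_(x in Omega) (psi (T n x))%:E =
      \int[lambda]_(x in Omega) (psi x)%:E +
      (t n)%:E * \int[lambda]_(x in Omega) (q n x)%:E)%E.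
    rewrite -(integralZl mO (q_int n)).
    rewrite -(integralD mO psi_int (integrableZl mO (t n) (q_int n))).
    apply: eq_integral => x _.
    by rewrite -EFinM -EFinD /q mulVKf ?gt_eqF// addrC subrK.
  rewrite -[leRHS]adde0 leeD2lE ?integrable_fin_num//.
  by rewrite pmule_rle0// lte_fin.
have [] := @dominated_convergence _ _ _ lambda Omega mO (fun n => EFin \o q n)
  (fun x => (dotmul (gradphi x) (grad psi x))%:E) (EFin \o G).
- by move=> n; exact/measurable_EFinP.
- apply/measurable_EFinP; apply: (@measurable_fun_cvg _ (Leb R d) R Omega q) => // x _.
  exact: cvg_difference_quotient.
- apply: aeW => x _; apply: cvg_EFin; first exact: nearW.
  exact: cvg_difference_quotient.
- by [].
- by apply: aeW => x n _; rewrite lee_fin.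
move=> _ _ cvgq; rewrite leeNr oppe0.
apply: (cvge_le _ cvgq); exact: nearW.
Qed.
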